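(* Let $\Gamma=\langle a,b,c\rangle\le \mathrm{Aut}(X^* )$ be the Hanoi towers group on three pegs. Then its rigid kernel $\ker(\widetilde{\Gamma}\to\overline{\Gamma})$ is the Klein four-group, i.e. it is isomorphic to $C_2\times C_2$, where $C_2$ is the cyclic group of order $2$.
   Context: Let $X=\{1,2,3\}$ and let $X^*$ be the infinite rooted ternary tree: its vertices are the finite words over $X$, the root is the empty word $\varnothing$, and each word $w$ is joined to $wx$ for $x\in X$. The level $|u|$ of a vertex $u$ is its length as a word. $\mathrm{Aut}(X^* )$ is the group of root-preserving, edge-preserving bijections of the vertex set; it acts on the right, $u\mapsto u^g$. For $g\in\mathrm{Aut}(X^* )$ and a vertex $u$, the state $g@u\in\mathrm{Aut}(X^* )$ is the automorphism determined by $(uw)^g=u^g\,w^{g@u}$ for all words $w$. One writes $g=(g_1,g_2,g_3)\sigma$ when $g_i=g@i$ for $i\in X$ and $\sigma\in S_3$ is the permutation by which $g$ acts on the first level $X$. The Hanoi towers group is $\Gamma=\langle a,b,c\rangle$, where $a,b,c\in\mathrm{Aut}(X^* )$ are defined recursively by $a=(a,1,1)\sigma_{23}$, $b=(1,b,1)\sigma_{13}$, $c=(1,1,c)\sigma_{12}$, with $\sigma_{ij}$ the transposition of $i$ and $j$. (So $a$ finds the first letter of a word lying in $\{2,3\}$ and swaps it with the other element of $\{2,3\}$; $b$ and $c$ do the same with $\{1,3\}$ and $\{1,2\}$.) For $G\le\mathrm{Aut}(X^* )$ and $n\ge 0$: $\mathrm{Stab}_G(n)$ is the subgroup of elements of $G$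 fixing every vertex of level $n$; for a vertex $u$, $\mathrm{Rist}_G(u)$ is the subgroup of elements of $G$ acting trivially outside the subtree of words with prefix $u$ (they fix every vertex not having $u$ as prefix); and $\mathrm{Rist}_G(n)=\langle \mathrm{Rist}_G(u) : |u|=n\rangle=\prod_{|u|=n}\mathrm{Rist}_G(u)$, a normal subgroup of $G$ contained in $\mathrm{Stab}_G(n)$. The congruence completion of $\Gamma$ is $\overline{\Gamma}=\varprojlim_{n\ge1}\Gamma/\mathrm{Stab}_\Gamma(n)$ and the branch completion is $\widetilde{\Gamma}=\varprojlim_{n\ge1}\Gamma/\mathrm{Rist}_\Gamma(n)$ (with the natural projection maps). The map $\widetilde{\Gamma}\to\overline{\Gamma}$ is the one induced by the quotient maps $\Gamma/\mathrm{Rist}_\Gamma(n)\to\Gamma/\mathrm{Stab}_\Gamma(n)$; its kernel is called the rigid kernel. *)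

(* Defs.v *)
From HB Require Import structures.
From mathcomp Require Import all_boot perm zmodp.
From mathcomp Require Import boolp.

Set Implicit Arguments.
Unset Strict Implicit.
Unset Printing Implicit Defensive.

Local Open Scope quotient_scope.
Local Open Scope group_scope.

Section Subgroup.
Variables (G : groupType) (H : groupClosed G).

Definition subgrp := {x : G | x \in H}.

HB.instance Definition _ := SubChoice.on subgrp.

Fact subgrp_closed : group_closed (fun x => x \in H).
Proof. by split=> [|x y]; [exact: gpred1 | exact: gpredF]. Qed.

HB.instance Definition _ :=
  SubChoice_isSubGroup.Build G (fun x => x \in H) subgrp subgrp_closed.

End Subgroup.

Section Generated.
Variables (G : groupType) (S : {pred G}).

Definition generated : {pred G} :=
  fun x => `[< forall H : groupClosed G, {subset S <= H} -> x \in H >].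

Lemma generatedP x :
  reflect (forall H : groupClosed G, {subset S <= H} -> x \in H)
          (x \in generated).
Proof. exact: asboolP. Qed.

Fact generatedM : mulg_closed generated.
Proof.
move=> x y /generatedP xS /generatedP yS; apply/generatedP => H SH.
by apply: gpredM; [exact: xS | exact: yS].
Qed.

Fact generated1 : 1 \in generated.
Proof. by apply/generatedP => H _; exact: gpred1. Qed.

Fact generatedV : invg_closed generated.
Proof.
move=> x /generatedP xS; apply/generatedP => H SH.
by rewrite gpredV; exact: xS.
Qed.

HB.instance Definition _ := isMulClosed.Build G generated generatedM.
HB.instance Definition _ := isMul1Closed.Build G generated generated1.
HB.instance Definition _ := isInvClosed.Build G generated generatedV.

Lemma mem_generated : {subset S <= generated}.
Proof. by move=> x Sx; apply/generatedP => H; apply. Qed.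

End Generated.

HB.mixin Record isNormal (G : groupType) (N : {pred G}) := {
  gpredJr : forall x g, x \in N -> x ^ g \in N
}.

#[short(type="normalClosed")]
HB.structure Definition NormalClosed (G : groupType) :=
  {N of isNormal G N & GroupClosed G N}.

Section GeneratedNormal.
Variables (G : groupType) (S : {pred G}).
Hypothesis SJ : forall x g, x \in S -> x ^ g \in S.

Section Conj.
Variables (H : groupClosed G) (g : G).
Definition conj_pre : {pred G} := fun x => x ^ g \in H.
Fact conj_preM : mulg_closed conj_pre.
Proof. by move=> x y xH yH; rewrite unfold_in conjMg; exact: gpredM. Qed.
Fact conj_pre1 : 1 \in conj_pre.
Proof. by rewrite unfold_in conj1g; exact: gpred1. Qed.
Fact conj_preV : invg_closed conj_pre.
Proof. by move=> x xH; rewrite unfold_in conjVg gpredV. Qed.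
HB.instance Definition _ := isMulClosed.Build G conj_pre conj_preM.
HB.instance Definition _ := isMul1Closed.Build G conj_pre conj_pre1.
HB.instance Definition _ := isInvClosed.Build G conj_pre conj_preV.
End Conj.

Lemma generatedJ x g : x \in generated S -> x ^ g \in generated S.
Proof.
move=> /generatedP xS; apply/generatedP => H SH.
have /xS : {subset S <= conj_pre H g} by move=> y /(SJ g) /SH.
by [].
Qed.

End GeneratedNormal.

Section Quotient.
Variables (G : groupType) (N : normalClosed G).

Definition coset_equiv (x y : G) : bool := x^-1 * y \in N.

Fact coset_equiv_refl : reflexive coset_equiv.
Proof. by move=> x; rewrite /coset_equiv mulVg; exact: gpred1. Qed.

Fact coset_equiv_sym : symmetric coset_equiv.
Proof. by move=> x y; rewrite /coset_equiv -gpredV invgM invgK. Qed.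

Fact coset_equiv_trans : transitive coset_equiv.
Proof.
move=> y x z xy yz; rewrite /coset_equiv.
by rewrite -[z](mulVKg y) mulgA; exact: gpredM.
Qed.

Canonical coset_equivRel :=
  EquivRel coset_equiv coset_equiv_refl coset_equiv_sym coset_equiv_trans.

Definition quot := {eq_quot coset_equivRel}.

HB.instance Definition _ := Choice.on quot.
HB.instance Definition _ := EqQuotient.on quot.

Lemma eq_quotP x y : reflect (\pi_quot x = \pi_quot y) (x^-1 * y \in N).
Proof. exact: (@eqmodP _ coset_equivRel x y). Qed.

Lemma quot_reprP x : (repr (\pi_quot x))^-1 * x \in N.
Proof. by apply/eq_quotP; rewrite reprK. Qed.

Definition quot_mul (u v : quot) : quot := \pi_quot (repr u * repr v).
Definition quot_one : quot := \pi_quot 1.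
Definition quot_inv (u : quot) : quot := \pi_quot (repr u)^-1.

Lemma quot_mulE x y :
  quot_mul (\pi_quot x) (\pi_quot y) = \pi_quot (x * y).
Proof.
apply/eq_quotP; rewrite invgM.
set rx := repr (\pi_quot x); set ry := repr (\pi_quot y).
have -> : ry^-1 * rx^-1 * (x * y) = (rx^-1 * x) ^ ry * (ry^-1 * y).
  by rewrite conjgE !mulgA mulgK.
by apply: gpredM; [apply: gpredJr|]; exact: quot_reprP.
Qed.

Lemma quot_invE x : quot_inv (\pi_quot x) = \pi_quot x^-1.
Proof.
apply/eq_quotP; rewrite invgK -gpredV invgM invgK.
set rx := repr (\pi_quot x).
have -> : x * rx^-1 = (rx^-1 * x) ^ rx^-1.
  by rewrite conjgE invgK !mulgA mulgV mul1g.
apply: gpredJr; exact: quot_reprP.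
Qed.

Fact quot_mulA : associative quot_mul.
Proof.
elim/quotW=> x; elim/quotW=> y; elim/quotW=> z.
rewrite (quot_mulE y z) (quot_mulE x (y * z)) (quot_mulE x y).
by rewrite (quot_mulE (x * y) z) mulgA.
Qed.
Fact quot_mul1 : left_id quot_one quot_mul.
Proof. by elim/quotW=> x; rewrite (quot_mulE 1 x) mul1g. Qed.
Fact quot_mul1r : right_id quot_one quot_mul.
Proof. by elim/quotW=> x; rewrite (quot_mulE x 1) mulg1. Qed.
Fact quot_mulV : left_inverse quot_one quot_inv quot_mul.
Proof. by elim/quotW=> x; rewrite (quot_invE x) (quot_mulE x^-1 x) mulVg. Qed.
Fact quot_mulVr : right_inverse quot_one quot_inv quot_mul.
Proof. by elim/quotW=> x; rewrite (quot_invE x) (quot_mulE x x^-1) mulgV. Qed.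

HB.instance Definition _ := isGroup.Build quot
  quot_mulA quot_mul1 quot_mul1r quot_mulV quot_mulVr.

End Quotient.

Section QuotientProjection.
Variables (G : groupType) (N M : normalClosed G).

(* The class of x modulo N is sent to the class of x modulo M (quot_projE);
   the inclusion is an argument because only then is the map well defined
   and a morphism *)
Definition quot_proj (NM : {subset N <= M}) (u : quot N) : quot M :=
  \pi_(quot M) (repr u).

Variable NM : {subset N <= M}.

Lemma quot_projE x : quot_proj NM (\pi_(quot N) x) = \pi_(quot M) x.
Proof. by apply/eq_quotP/NM/quot_reprP. Qed.

Fact quot_proj_morph : monoid_morphism (quot_proj NM).
Proof.
split; first exact: quot_projE.
elim/quotW=> x; elim/quotW=> y.
rewrite -[LHS]/(quot_proj NM (quot_mul _ _)) -[RHS]/(quot_mul _ _).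
by rewrite (quot_mulE N x y) !quot_projE (quot_mulE M x y).
Qed.

HB.instance Definition _ :=
  isUMagmaMorphism.Build (quot N) (quot M) (quot_proj NM) quot_proj_morph.

End QuotientProjection.

Section Kernel.
Variables (G H : groupType) (f : UMagmaMorphism.type G H).

Definition kernel : {pred G} := fun x => f x == 1.

Fact kernelM : mulg_closed kernel.
Proof.
move=> x y; rewrite !unfold_in => /eqP xK /eqP yK.
by rewrite gmulfM xK yK mulg1.
Qed.
Fact kernel1 : 1 \in kernel.
Proof. by rewrite unfold_in gmulf1. Qed.
Fact kernelV : invg_closed kernel.
Proof. by move=> x; rewrite !unfold_in gmulfV => /eqP ->; rewrite invg1. Qed.

HB.instance Definition _ := isMulClosed.Build G kernel kernelM.
HB.instance Definition _ := isMul1Closed.Build G kernel kernel1.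
HB.instance Definition _ := isInvClosed.Build G kernel kernelV.

End Kernel.

Definition isomorphic (G H : groupType) : Prop :=
  exists f : {multiplicative G -> H}, bijective f.

Record inv_system := InvSystem {
  obj : nat -> groupType;
  bond : forall n, UMagmaMorphism.type (obj n.+1) (obj n)
}.

Section DirectProduct.
Variable T : nat -> groupType.

Definition seqprod := forall n, T n.

HB.instance Definition _ := gen_eqMixin seqprod.
HB.instance Definition _ := gen_choiceMixin seqprod.

Definition seqprod_mul (x y : seqprod) : seqprod := fun n => x n * y n.
Definition seqprod_one : seqprod := fun n => 1.
Definition seqprod_inv (x : seqprod) : seqprod := fun n => (x n)^-1.

Fact seqprod_mulA : associative seqprod_mul.
Proof.
by move=> x y z; apply: functional_extensionality_dep => n; exact: mulgA.
Qed.
Fact seqprod_mul1 : left_id seqprod_one seqprod_mul.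
Proof.
by move=> x; apply: functional_extensionality_dep => n; exact: mul1g.
Qed.
Fact seqprod_mul1r : right_id seqprod_one seqprod_mul.
Proof.
by move=> x; apply: functional_extensionality_dep => n; exact: mulg1.
Qed.
Fact seqprod_mulV : left_inverse seqprod_one seqprod_inv seqprod_mul.
Proof.
by move=> x; apply: functional_extensionality_dep => n; exact: mulVg.
Qed.
Fact seqprod_mulVr : right_inverse seqprod_one seqprod_inv seqprod_mul.
Proof.
by move=> x; apply: functional_extensionality_dep => n; exact: mulgV.
Qed.

HB.instance Definition _ := isGroup.Build seqprod
  seqprod_mulA seqprod_mul1 seqprod_mul1r seqprod_mulV seqprod_mulVr.

End DirectProduct.

Section InverseLimit.
Variable S : inv_system.

Definition compatible : {pred seqprod (obj S)} :=
  fun x => `[< forall n, bond S n (x n.+1) = x n >].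

Fact compatibleM : mulg_closed compatible.
Proof.
move=> x y /asboolP xC /asboolP yC; apply/asboolP => n.
by rewrite [LHS]gmulfM xC yC.
Qed.
Fact compatible1 : 1 \in compatible.
Proof. by apply/asboolP => n; exact: gmulf1. Qed.
Fact compatibleV : invg_closed compatible.
Proof. by move=> x /asboolP xC; apply/asboolP => n; rewrite [LHS]gmulfV xC. Qed.

HB.instance Definition _ := isMulClosed.Build _ compatible compatibleM.
HB.instance Definition _ := isMul1Closed.Build _ compatible compatible1.
HB.instance Definition _ := isInvClosed.Build _ compatible compatibleV.

Definition inv_lim := subgrp compatible.

HB.instance Definition _ := Group.on inv_lim.

End InverseLimit.

Section InverseLimitMap.
Variables (S S' : inv_system).
Variable f : forall n, UMagmaMorphism.type (obj S n) (obj S' n).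
Hypothesis fC : forall n x, bond S' n (f n.+1 x) = f n (bond S n x).

Fact inv_lim_map_subproof (x : inv_lim S) :
  ((fun n => f n (val x n)) : seqprod (obj S')) \in @compatible S'.
Proof.
by apply/asboolP => n; rewrite fC; have /asboolP -> := valP x.
Qed.

Definition inv_lim_map (x : inv_lim S) : inv_lim S' :=
  exist (fun y => y \in @compatible S') _ (inv_lim_map_subproof x).

Fact inv_lim_map_morph : monoid_morphism inv_lim_map.
Proof.
split=> [|x y]; apply: val_inj; apply: functional_extensionality_dep => n /=.
  exact: gmulf1.
exact: gmulfM.
Qed.

HB.instance Definition _ :=
  isUMagmaMorphism.Build (inv_lim S) (inv_lim S') inv_lim_map inv_lim_map_morph.

End InverseLimitMap.

(* The letters 1, 2, 3 are the elements 0, 1, 2 of 'I_3 *)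
Notation letter := 'I_3.
Notation vertex := (seq letter).

Definition l1 : letter := @Ordinal 3 0 isT.
Definition l2 : letter := @Ordinal 3 1 isT.
Definition l3 : letter := @Ordinal 3 2 isT.

Definition adjacent : rel vertex := fun u v =>
  [exists x : letter, (v == rcons u x) || (u == rcons v x)].

Record aut := Aut {
  aut_fun :> vertex -> vertex;
  aut_bij : bijective aut_fun;
  aut_root : aut_fun [::] = [::];
  aut_adj : forall u v, adjacent (aut_fun u) (aut_fun v) = adjacent u v
}.

Lemma autP (g h : aut) : (forall u, g u = h u) -> g = h.
Proof.
case: g h => [g p q r] [h p' q' r'] /= gh.
have {}gh : g = h by apply: functional_extensionality_dep.
by subst h; congr Aut; exact: Prop_irrelevance.
Qed.

HB.instance Definition _ := gen_eqMixin aut.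
HB.instance Definition _ := gen_choiceMixin aut.

Definition aut_one : aut :=
  @Aut id (Bijective (frefl _) (frefl _)) erefl (fun _ _ => erefl).

Section AutMul.
Variables g h : aut.
Fact aut_mul_bij : bijective (h \o g).
Proof. by apply: bij_comp; exact: aut_bij. Qed.
Fact aut_mul_root : (h \o g) [::] = [::].
Proof. by rewrite /= !aut_root. Qed.
Fact aut_mul_adj u v : adjacent ((h \o g) u) ((h \o g) v) = adjacent u v.
Proof. by rewrite /= !aut_adj. Qed.
(* right action, u^(gh) = (u^g)^h *)
Definition aut_mul : aut := Aut aut_mul_bij aut_mul_root aut_mul_adj.
End AutMul.

Section AutInv.
Variable g : aut.
Fact aut_inv_exists : exists f, cancel g f /\ cancel f g.
Proof. by have [f gK fK] := aut_bij g; exists f. Qed.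
Definition aut_inv_fun := projT1 (cid aut_inv_exists).
Lemma aut_funK : cancel g aut_inv_fun.
Proof. by rewrite /aut_inv_fun; case: cid => f []. Qed.
Lemma aut_inv_funK : cancel aut_inv_fun g.
Proof. by rewrite /aut_inv_fun; case: cid => f []. Qed.
Fact aut_inv_bij : bijective aut_inv_fun.
Proof. exact: Bijective aut_inv_funK aut_funK. Qed.
Fact aut_inv_root : aut_inv_fun [::] = [::].
Proof. by rewrite -[in LHS](aut_root g) aut_funK. Qed.
Fact aut_inv_adj u v : adjacent (aut_inv_fun u) (aut_inv_fun v) = adjacent u v.
Proof. by rewrite -(aut_adj g) !aut_inv_funK. Qed.
Definition aut_inv : aut := Aut aut_inv_bij aut_inv_root aut_inv_adj.
End AutInv.

Fact aut_mulA : associative aut_mul.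
Proof. by move=> g h k; apply: autP. Qed.
Fact aut_mul1 : left_id aut_one aut_mul.
Proof. by move=> g; apply: autP. Qed.
Fact aut_mul1r : right_id aut_one aut_mul.
Proof. by move=> g; apply: autP. Qed.
Fact aut_mulV : left_inverse aut_one aut_inv aut_mul.
Proof. by move=> g; apply: autP => u; exact: aut_inv_funK. Qed.
Fact aut_mulVr : right_inverse aut_one aut_inv aut_mul.
Proof. by move=> g; apply: autP => u; exact: aut_funK. Qed.

HB.instance Definition _ := isGroup.Build aut
  aut_mulA aut_mul1 aut_mul1r aut_mulV aut_mulVr.

Lemma autM (g h : aut) u : (g * h) u = h (g u).
Proof. by []. Qed.

Lemma autK (g : aut) : cancel g (g^-1 : aut).
Proof. exact: aut_funK. Qed.

Lemma autVK (g : aut) : cancel (g^-1 : aut) g.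
Proof. exact: aut_inv_funK. Qed.

Lemma aut_inj (g : aut) : injective g.
Proof. exact: can_inj (autK g). Qed.

Lemma adjacent_rcons u x : adjacent u (rcons u x).
Proof. by apply/existsP; exists x; rewrite eqxx. Qed.

Lemma aut_rcons (g : aut) u x : exists y, g (rcons u x) = rcons (g u) y.
Proof.
have [n] := ubnP (size u); elim: n u x => // n IHn u x /ltnSE le_u.
have : adjacent (g u) (g (rcons u x)) by rewrite aut_adj adjacent_rcons.
case/existsP => y /orP[/eqP ->|/eqP gu]; first by exists y.
case/lastP: u => [|u z] in le_u gu *.
  by move: gu; rewrite aut_root => /(congr1 size); rewrite size_rcons.
have [] := IHn u z; first by rewrite size_rcons in le_u.
move=> t gz; move: gu; rewrite gz => /rcons_inj[/aut_inj] /(congr1 size).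
by rewrite !size_rcons => /eqP; rewrite (ltn_eqF (leqW (leqnn (size u).+1))).
Qed.

Lemma size_aut (g : aut) u : size (g u) = size u.
Proof.
elim/last_ind: u => [|u x IHu]; first by rewrite aut_root.
by have [y ->] := aut_rcons g u x; rewrite !size_rcons IHu.
Qed.

Lemma prefix_aut (g : aut) u v : prefix (g u) (g v) = prefix u v.
Proof.
have pref (h : aut) s t : prefix s t -> prefix (h s) (h t).
  case/prefixP => w ->; elim/last_ind: w => [|w x IHw].
    by rewrite cats0 prefix_refl.
  rewrite -rcons_cat; have [y ->] := aut_rcons h (s ++ w) x.
  exact: prefix_trans IHw (prefix_rcons _ _).
by apply/idP/idP => [/(pref g^-1)|/pref //]; rewrite !autK.
Qed.

(* [hanoi_fun k i j] is the map g with g = (g_1, g_2, g_3)(i j), where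
   g_k = g and the two other states are trivial *)
Fixpoint hanoi_fun (k i j : letter) (u : vertex) : vertex :=
  if u is x :: w then tperm i j x :: (if x == k then hanoi_fun k i j w else w)
  else [::].

Section Hanoi.
Variables k i j : letter.
Hypotheses (ki : k != i) (kj : k != j).

Fact hanoi_funK : involutive (hanoi_fun k i j).
Proof.
elim=> //= x w IHw; rewrite tpermK; congr (_ :: _).
have -> : (tperm i j x == k) = (x == k).
  have kt : tperm i j k = k by rewrite tpermD // eq_sym.
  by rewrite -{1}kt (inj_eq perm_inj).
by case: eqP.
Qed.

Fact hanoi_fun_rcons u x :
  exists y, hanoi_fun k i j (rcons u x) = rcons (hanoi_fun k i j u) y.
Proof.
elim: u => [|z u [y IHu]] /=; first by exists (tperm i j x); rewrite if_same.
by case: eqP => _; [exists y; rewrite IHu | exists x].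
Qed.

Fact hanoi_fun_adj u v :
  adjacent (hanoi_fun k i j u) (hanoi_fun k i j v) = adjacent u v.
Proof.
have pres s t :
    adjacent s t -> adjacent (hanoi_fun k i j s) (hanoi_fun k i j t).
  case/existsP => x /orP[] /eqP ->.
    by have [y ->] := hanoi_fun_rcons s x; exact: adjacent_rcons.
  have [y ->] := hanoi_fun_rcons t x.
  by apply/existsP; exists y; rewrite eqxx orbT.
by apply/idP/idP => [/pres|/pres //]; rewrite !hanoi_funK.
Qed.

Definition hanoi : aut :=
  @Aut (hanoi_fun k i j) (inv_bij hanoi_funK) erefl hanoi_fun_adj.

End Hanoi.

Definition ha : aut := @hanoi l1 l2 l3 isT isT.
Definition hb : aut := @hanoi l2 l1 l3 isT isT.
Definition hc : aut := @hanoi l3 l1 l2 isT isT.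

Definition Gamma : {pred aut} := generated (mem [:: ha; hb; hc]).

HB.instance Definition _ := GroupClosed.on Gamma.

Section RigidKernel.
Variable G : groupClosed aut.

Definition stab (n : nat) : {pred subgrp G} :=
  fun g => `[< forall u, size u = n -> val g u = u >].

Definition rist_vertex (u : vertex) : {pred subgrp G} :=
  fun g => `[< forall v, ~~ prefix u v -> val g v = v >].

Definition rist (n : nat) : {pred subgrp G} :=
  generated (fun g => `[< exists2 u, size u = n & g \in rist_vertex u >]).

HB.instance Definition _ n := GroupClosed.on (rist n).

Fact stabM n : mulg_closed (stab n).
Proof.
move=> g h /asboolP gS /asboolP hS; apply/asboolP => u un.
by rewrite valM autM gS // hS.
Qed.
Fact stab1 n : 1 \in stab n.
Proof. by apply/asboolP. Qed.
Fact stabV n : invg_closed (stab n).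
Proof.
move=> g /asboolP gS; apply/asboolP => u un.
by rewrite -[in LHS](gS u un); exact: autK.
Qed.
Fact stabJ n g h : g \in stab n -> g ^ h \in stab n.
Proof.
move=> /asboolP gS; apply/asboolP => u un; rewrite conjgE !valM !autM.
by rewrite gS ?size_aut //; exact: autVK.
Qed.

HB.instance Definition _ n := isMulClosed.Build _ (stab n) (@stabM n).
HB.instance Definition _ n := isMul1Closed.Build _ (stab n) (stab1 n).
HB.instance Definition _ n := isInvClosed.Build _ (stab n) (@stabV n).
HB.instance Definition _ n := isNormal.Build _ (stab n) (@stabJ n).

Fact ristJ n g h : g \in rist n -> g ^ h \in rist n.
Proof.
apply: generatedJ => {}g {}h /asboolP[u un /asboolP gR].
apply/asboolP; exists (val h u); first by rewrite size_aut.
apply/asboolP => v huv; rewrite conjgE !valM !autM gR; first exact: autVK.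
by apply: contra huv; rewrite -(prefix_aut (val h)) autVK.
Qed.

HB.instance Definition _ n := isNormal.Build _ (rist n) (@ristJ n).

Lemma stabS n : {subset stab n.+1 <= stab n}.
Proof.
move=> g /asboolP gS; apply/asboolP => u un.
have := gS (rcons u l1); rewrite size_rcons un => /(_ erefl).
by have [y ->] := aut_rcons (val g) u l1 => /rcons_inj[].
Qed.

Lemma ristS n : {subset rist n.+1 <= rist n}.
Proof.
move=> g /generatedP; apply => {}g /asboolP[u un /asboolP gR].
apply: mem_generated; apply/asboolP; case/lastP: u => // u x in un gR *.
exists u; first by move: un; rewrite size_rcons => -[].
apply/asboolP => v uv; apply: gR; apply: contra uv.
exact: prefix_trans (prefix_rcons _ _).
Qed.

Lemma rist_stab n : {subset rist n <= stab n}.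
Proof.
move=> g /generatedP; apply => {}g /asboolP[u un /asboolP gR].
have fix_ne v : size v = n -> v <> u -> val g v = v.
  move=> vn vu; apply: gR; apply/negP => /prefixP[w vE]; apply: vu.
  have /size0nil w0 : size w = 0.
    by apply/eqP; rewrite -(eqn_add2l n) -{1}un -size_cat -vE vn addn0.
  by rewrite vE w0 cats0.
apply/asboolP => v vn; have [vu|/eqP vu] := eqVneq v u; last exact: fix_ne.
apply/eqP/negPn/negP => /eqP gv; apply: (gv).
by apply: (@aut_inj (val g)); apply: fix_ne; rewrite ?size_aut // -vu.
Qed.

(* The systems are indexed from 0, so the n-th term is the quotient at
   level n + 1 *)
Definition congruence_system : inv_system :=
  @InvSystem (fun n => quot (stab n.+1)) (fun n => quot_proj (@stabS n.+1)).

Definition branch_system : inv_system :=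
  @InvSystem (fun n => quot (rist n.+1)) (fun n => quot_proj (@ristS n.+1)).

Definition congruence_completion : groupType := inv_lim congruence_system.
Definition branch_completion : groupType := inv_lim branch_system.

Fact branch_to_congruence_subproof n (x : obj branch_system n.+1) :
  bond congruence_system n (quot_proj (@rist_stab n.+2) x)
  = quot_proj (@rist_stab n.+1) (bond branch_system n x).
Proof. by rewrite -[x]reprK /= !quot_projE. Qed.

Definition branch_to_congruence :
    UMagmaMorphism.type branch_completion congruence_completion :=
  @inv_lim_map branch_system congruence_system
    (fun n => quot_proj (@rist_stab n.+1)) branch_to_congruence_subproof.

Definition rigid_kernel : groupType := subgrp (kernel branch_to_congruence).

End RigidKernel.

(* Main.v *)
From HB Require Import structures.
Require Import Defs.
From mathcomp Require Import all_boot perm zmodp.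
From mathcomp Require Import ssralg boolp.

Set Implicit Arguments.
Unset Strict Implicit.
Unset Printing Implicit Defensive.

Import GRing.Theory(opprD, opprK, addKr, addrA, subrK, addrK).
Local Open Scope quotient_scope.
Local Open Scope group_scope.

(** An element of Gamma that fixes the vertices up to level n is, modulo
    Rist(n), described by the classes of its 3^n states in the abelianization
    of Gamma.  The proof determines which classes occur, and then passes to
    the limit.

    Elements of Gamma are handled through words in a, b, c, whose states are
    again words.  The parities of the numbers of letters a, b and c in a word
    depend only on the automorphism it represents (eq_par); they give a
    morphism from Gamma onto (Z/2)^3, whose kernel K is the commutator
    subgroup.

    Two facts describe the elements g = (g1, g2, g3) of Stab(1).  First, the
    parity vectors of g1, g2 and g3 differ pairwise by 0 or by (1, 1, 1), and
    the parity vector of g, which is their sum, has an even number of ones.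
    So if two of the states are trivial, the third one and g lie in K
    (sec_par0), and if all three states have even length, the three parity
    vectors agree with each other and with that of g (sec_par_eq).  Second,
    Gamma is branch over K: every element of K, put at any vertex as the only
    nontrivial state, gives an element of Gamma, again in K (lift_vertex).
    Hence Rist(u) is a copy of K for every vertex u other than the root, and
    Rist(n) consists, for n > 0, of the elements of Stab(n) whose states at
    level n all lie in K.

    If g is in Stab(n+1), its states above that level have even length
    because they fix the first level, so all its states at level n have the
    parity vector of g itself (secs_par).  In particular
      Stab(n+1) /\ K is contained in Rist(n), and Rist(n) in K,  for n > 0
    (stab_chi_rist, rist_chi).  An element of the rigid kernel is a
    compatible sequence of classes x_n in Stab(n) / Rist(n); by these
    inclusions it is determined by the parity vector of any x_n, which is the
    same for all n.  This vector has an even number of ones, since elements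
    of Stab(1) have even length.  Conversely every such vector is the parity
    vector of an element of Stab(n), for every n: if g has even length, then
    Gamma contains (g, g, g), which has the same parity vector as g (diag).
    The rigid kernel is therefore the group of vectors of (Z/2)^3 with an
    even number of ones, and the first two coordinates identify it with
    Z/2 x Z/2. *)

(** * Words in the generators and their states *)

Lemma letter_ind (P : letter -> Prop) : P l1 -> P l2 -> P l3 -> forall x, P x.
Proof.
move=> P1 P2 P3 [[|[|[|//]]] i3].
- by rewrite (_ : Ordinal i3 = l1) //; exact: val_inj.
- by rewrite (_ : Ordinal i3 = l2) //; exact: val_inj.
- by rewrite (_ : Ordinal i3 = l3) //; exact: val_inj.
Qed.

(** For k <> x this is the peg different from both, since the three letters
    add up to 0 modulo 3; for k = x it is k, as 3 k = 0.  Hence third k is the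
    transposition of the two letters other than k. *)
Definition third (k x : letter) : letter := (- (k + x))%R.

Lemma thirdK k : involutive (third k).
Proof. by move=> x; rewrite /third opprD opprK addKr. Qed.

Lemma third_id k : third k k = k.
Proof. by elim/letter_ind: k; apply: val_inj. Qed.

(** The letter k stands for the generator fixing the peg k. *)
Definition gen (k : letter) : aut := nth 1 [:: ha; hb; hc] k.

Lemma gen_cons k x u :
  gen k (x :: u) = third k x :: (if x == k then gen k u else u).
Proof.
elim/letter_ind: k; elim/letter_ind: x => /=; congr (_ :: _); apply: val_inj;
  by rewrite ?tpermL ?tpermR ?tpermD.
Qed.

Lemma genK k : gen k * gen k = 1.
Proof.
by apply: autP => u; rewrite autM; elim/letter_ind: k; exact: hanoi_funK.
Qed.

Lemma genV k : (gen k)^-1 = gen k.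
Proof. by apply: (mulgI (gen k)); rewrite mulgV genK. Qed.

Notation word := (seq letter).

Definition ev (w : word) : aut := foldr (fun k g => gen k * g) 1 w.

Lemma ev_cat v w : ev (v ++ w) = ev v * ev w.
Proof. by elim: v => [|k v /= ->]; rewrite ?mul1g ?mulgA. Qed.

Lemma ev_rev w : ev (rev w) = (ev w)^-1.
Proof.
elim: w => [|k w IHw]; first by rewrite invg1.
by rewrite rev_cons -cats1 ev_cat IHw /= mulg1 invgM genV.
Qed.

(** The action on the first letter, and the states: the automorphism of a word
    w sends x :: u to img w x followed by the image of u under sec w x.  The
    letters of w are read from the left, which is the order of a right
    action. *)
Fixpoint img (w : word) (x : letter) : letter :=
  if w is k :: w' then img w' (third k x) else x.

Fixpoint sec (w : word) (x : letter) : word :=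
  if w is k :: w' then
    let s := sec w' (third k x) in if x == k then k :: s else s
  else [::].

Fixpoint secs (w : word) (v : vertex) : word :=
  if v is x :: v' then secs (sec w x) v' else w.

Lemma ev_cons w x u : ev w (x :: u) = img w x :: ev (sec w x) u.
Proof.
elim: w x u => [//|k w IHw] x u.
by rewrite -[ev _]/(gen k * ev w) autM gen_cons IHw /=; case: ifP.
Qed.

Lemma ev_secs w v u : ev w (v ++ u) = ev w v ++ ev (secs w v) u.
Proof.
elim: v w => [|x v IHv] w; first by rewrite aut_root.
by rewrite cat_cons !ev_cons IHv.
Qed.

Lemma ev_sec_eq w x y g : (forall u, ev w (x :: u) = y :: g u) ->
  forall u, ev (sec w x) u = g u.
Proof. by move=> wE u; have := wE u; rewrite ev_cons => -[]. Qed.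

(** * Parities of words *)

Definition par (w : word) (k : letter) : bool := odd (count_mem k w).

Lemma par_cons c w k : par (c :: w) k = (c == k) (+) par w k.
Proof. by rewrite /par /= oddD oddb. Qed.

Lemma par_cat v w k : par (v ++ w) k = par v k (+) par w k.
Proof. by rewrite /par count_cat oddD. Qed.

Lemma par_rev w k : par (rev w) k = par w k.
Proof. by rewrite /par count_rev. Qed.

Lemma odd_size_par w : odd (size w) = par w l1 (+) par w l2 (+) par w l3.
Proof.
elim: w => //= c w ->; rewrite !par_cons.
by case: (par w l1); case: (par w l2); case: (par w l3); elim/letter_ind: c.
Qed.

(** Reading a letter c adds a letter, namely c, to the state at exactly one
    vertex of the first level. *)
Lemma count_sec a w : count a w = \sum_(x : letter) count a (sec w x).
Proof.
elim: w => [|c w IHw]; first by rewrite big1.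
rewrite /= IHw (reindex_inj (inv_inj (thirdK c))) /=.
rewrite (bigD1 c) //= [in RHS](bigD1 c) //= eqxx third_id /= addnA.
by congr (_ + _)%N; apply: eq_bigr => x xc; rewrite (negPf xc).
Qed.

Lemma par_sec w k :
  par w k = par (sec w l1) k (+) par (sec w l2) k (+) par (sec w l3) k.
Proof.
rewrite /par count_sec !big_ord_recl big_ord0 addn0 addnA !oddD.
by congr (odd (count _ (sec _ _)) (+) odd (count _ (sec _ _))
          (+) odd (count _ (sec _ _))); apply: val_inj.
Qed.

(** The mixed second difference of a matrix over Z/2; it vanishes on the
    matrices of the form (row term) + (column term). *)
Definition square (m : letter -> letter -> bool) i j k l : bool :=
  m i k (+) m j k (+) m i l (+) m j l.

Lemma eq_square m m' i j k l : (forall x y, m x y = m' x y) ->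
  square m i j k l = square m' i j k l.
Proof. by move=> mE; rewrite /square !mE. Qed.

Lemma squareD m m' i j k l :
  square (fun x y => m x y (+) m' x y) i j k l
  = square m i j k l (+) square m' i j k l.
Proof.
rewrite /square; case: (m i k); case: (m j k); case: (m i l); case: (m j l);
by case: (m' i k); case: (m' j k); case: (m' i l); case: (m' j l).
Qed.

(** The 3 x 3 matrix of parities of the states of w differs from the
    permutation matrix of w by the identity matrix and a sum of a row term and
    a column term.  Prepending a letter c swaps two rows of both matrices and
    adds the matrix unit E_cc to the first one; and E_cc plus the permutation
    matrix of c plus the identity is the sum of the matrix of all ones, the
    matrix of row c and that of column c, on which square vanishes. *)
Lemma square_sec w i j k l :
  square (fun x y => par (sec w x) y (+) (img w x == y)) i j k l
  = square (fun x y => x == y) i j k l.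
Proof.
elim: w i j => [|c w IHw] i j //=.
pose m x y := (x == c) && (c == y).
pose m' x y := par (sec w x) y (+) (img w x == y).
rewrite (@eq_square _ (fun x y => m x y (+) m' (third c x) y)); last first.
  by move=> x y; rewrite /m /m' addbA; case: (x == c); rewrite ?par_cons.
rewrite squareD -[X in _ (+) X]/(square m' (third c i) (third c j) k l) IHw.
rewrite {IHw}/m {m'}; elim/letter_ind: c; elim/letter_ind: i.
all: by elim/letter_ind: j; elim/letter_ind: k; elim/letter_ind: l.
Qed.

Lemma square_sec_id w i j k l : img w =1 id ->
  square (fun x y => par (sec w x) y) i j k l = false.
Proof.
move=> wid; have := square_sec w i j k l; rewrite squareD.
rewrite (@eq_square (fun x y => img w x == y) (fun x y => x == y)).
  by case: square; case: square.
by move=> x y; rewrite wid.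
Qed.

(** Each generator reverses the cyclic order of the three letters, so a word
    preserves it exactly when its length is even. *)
Lemma img_next w x :
  img w (x + 1)%R = (if odd (size w) then img w x - 1 else img w x + 1)%R.
Proof.
elim: w x => //= k w IHw x.
have -> : third k (x + 1)%R = (third k x - 1)%R.
  by rewrite /third addrA opprD.
have := IHw (third k x - 1)%R; rewrite subrK => ->.
by case: odd; rewrite /= ?subrK ?addrK.
Qed.

Lemma img_id_even w : img w =1 id -> odd (size w) = false.
Proof. by move=> wid; have := img_next w l1; rewrite !wid; case: odd. Qed.

Lemma ev1_img w : ev w = 1 -> img w =1 id.
Proof. by move=> w1 x; have := ev_cons w x [::]; rewrite w1 => -[]. Qed.

Lemma ev1_sec w x : ev w = 1 -> ev (sec w x) = 1.
Proof.
move=> w1; apply: autP; apply: (@ev_sec_eq _ _ x id) => u.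
by rewrite w1.
Qed.

(** The state at x has the full length only if every letter of w is recorded
    at x, and this forces all of them to be x. *)
Lemma size_sec w x : size (sec w x) <= size w ?= iff (w == nseq (size w) x).
Proof.
elim: w x => [|k w IHw] x; first exact/leqif_refl.
rewrite /= eqseq_cons; case: eqVneq => [->|xk] /=.
  by rewrite third_id; exact: IHw.
apply/leqifP; rewrite ltnS.
by case: (IHw (third k x)).
Qed.

(** Parities are the sums of the parities of the states, which represent the
    identity too.  These are shorter words, except for a power of a single
    generator, where the length is even. *)
Lemma ev1_par w k : ev w = 1 -> par w k = false.
Proof.
have [n] := ubnP (size w); elim: n w => // n IHn w /ltnSE le_wn w1.
have [/hasP[x _ /eqP wx]|] :=
  boolP (has (fun x => w == nseq (size w) x) [:: l1; l2; l3]).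
  have := img_id_even (ev1_img w1).
  by rewrite wx size_nseq /par count_nseq oddM => ->; rewrite andbF.
rewrite /= orbF !negb_or => /and3P[w_1 w_2 w_3].
have lt x : w != nseq (size w) x -> size (sec w x) < n.
  move=> wx; apply: leq_trans le_wn.
  by rewrite (ltn_leqif (size_sec w x)) wx.
by rewrite par_sec !IHn ?lt //; exact: ev1_sec.
Qed.

Lemma eq_par w w' k : ev w = ev w' -> par w k = par w' k.
Proof.
move=> ww'; have := @ev1_par (rev w ++ w') k; rewrite ev_cat ev_rev ww' mulVg.
by move/(_ erefl); rewrite par_cat par_rev; case: par; case: par.
Qed.

Lemma even_par3 w : odd (size w) = false ->
  par w l1 = par w l2 -> par w l2 = par w l3 -> forall k, par w k = false.
Proof.
rewrite odd_size_par => + e12 e23; rewrite e12 e23.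
by move=> e3; elim/letter_ind; move: e3; rewrite ?e12 ?e23; case: par.
Qed.

(** Differences between states are constant vectors by square_sec_id, and a
    constant vector of (Z/2)^3 with an even number of ones is 0. *)
Lemma sec_par_eq w : img w =1 id -> (forall x, odd (size (sec w x)) = false) ->
  forall x k, par (sec w x) k = par w k.
Proof.
move=> wid wev.
have eqs x y k : par (sec w x) k = par (sec w y) k.
  have sq l l' := square_sec_id x y l l' wid.
  have := wev x; have := wev y; rewrite !odd_size_par.
  move: (sq l1 l2) (sq l2 l3); rewrite /square.
  by elim/letter_ind: k; case: par; case: par; case: par;
     case: par; case: par; case: par.
move=> x k; rewrite (par_sec w) (eqs l1 x) (eqs l2 x) (eqs l3 x).
by case: par.
Qed.

(** This is why rigid stabilizers lie in the kernel of the parities: the state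
    at x is compared with a trivial one, so its parity vector is constant, and
    its number of ones is even because w fixes the first level. *)
Lemma sec_par0 w x : img w =1 id ->
  (forall y, y != x -> ev (sec w y) = 1) -> forall k, par w k = false.
Proof.
move=> wid w1.
have [y yx] : exists y : letter, y != x.
  by elim/letter_ind: x {w1}; [exists l2 | exists l1 | exists l1].
have parE k : par w k = par (sec w x) k.
  rewrite (par_sec w); have w0 z : z != x -> par (sec w z) k = false.
    by move/w1/ev1_par.
  elim/letter_ind: x w0 {w1 y yx} => w0.
  - by rewrite (w0 l2) // (w0 l3) // !addbF.
  - by rewrite (w0 l1) // (w0 l3) // addbF.
  - by rewrite (w0 l1) // (w0 l2).
have y0 k : par (sec w y) k = false by exact/ev1_par/w1.
apply: even_par3; first exact: img_id_even.
- have := square_sec_id x y l1 l2 wid; rewrite /square !y0 -!parE.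
  by case: par; case: par.
- have := square_sec_id x y l2 l3 wid; rewrite /square !y0 -!parE.
  by case: par; case: par.
Qed.

(** * The branching property *)

Definition liftable (g : aut) : Prop := forall x, exists w, forall y u,
  ev w (y :: u) = y :: (if y == x then g u else u).

Lemma liftable1 : liftable 1.
Proof. by move=> x; exists [::] => y u; rewrite if_same. Qed.

Lemma liftableM g h : liftable g -> liftable h -> liftable (g * h).
Proof.
move=> gL hL x; have [v vE] := gL x; have [w wE] := hL x.
by exists (v ++ w) => y u; rewrite ev_cat autM vE wE; case: eqP.
Qed.

(** Cancellation of squares of generators, with which identities between
    concrete words hold by computation. *)
Definition reduce (w : word) : word :=
  foldr (fun k s => if s is j :: s' then if k == j then s' else k :: s
                    else [:: k]) [::] w.

Lemma ev_reduce w : ev (reduce w) = ev w.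
Proof.
elim: w => //= k w <-; case: (reduce w) => //= j s.
by case: eqP => // ->; rewrite mulgA genK mul1g.
Qed.

(** Gamma has an element t that fixes the letter x with state k there, so
    conjugating by t an element with only state g, at x, turns g into its
    conjugate by k and leaves the other states trivial. *)
Lemma liftableJ g k : liftable g -> liftable (g ^ gen k).
Proof.
move=> gL x; have [w wE] := gL x.
(* for x <> k, the word k x k has state k at x and swaps k with x; the last
   letter undoes this permutation and has a trivial state at k *)
pose t := if x == k then [:: k] else [:: k; x; k; third k x].
have tx u : ev t (x :: u) = x :: gen k u.
  rewrite ev_cons -ev_reduce /t {t}.
  by elim/letter_ind: k; elim/letter_ind: x {w wE};
     congr (_ :: _); apply: val_inj.
exists (rev t ++ w ++ t) => y u; rewrite !ev_cat ev_rev !autM.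
have: (y :: u) = ev t ((ev t)^-1 (y :: u)) by rewrite autVK.
have := size_aut (ev t)^-1 (y :: u).
case: ((ev t)^-1 (y :: u)) => // z v _; rewrite wE.
case: (eqVneq z x) => [->|zx].
  by rewrite !tx => -[-> ->]; rewrite eqxx autK.
move=> yuE; rewrite -yuE; case: (eqVneq y x) => // yx.
case/negP: zx; move: yuE; rewrite yx ev_cons => -[xz _].
have: ev t [:: x] = ev t [:: z] by rewrite tx ev_cons -xz !aut_root.
by move/aut_inj => [->].
Qed.

(** If p, q, r are the three pegs, the square of the word p q r q has the
    commutator of p and r as its only nontrivial state, at p. *)
Lemma liftable_comm i j : liftable (ev [:: i; j; i; j]).
Proof.
move=> x.
pose c p r := [:: p; third p r; r; third p r; p; third p r; r; third p r].
(* at the third peg: conjugating by the generator j moves the subtree of i there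
   without changing the state *)
pose w := if i == j then [::] else if x == i then c i j
  else if x == j then rev (c j i) else j :: rcons (c i j) j.
exists w => y u; rewrite ev_cons -ev_reduce.
have -> : reduce (sec w y) = if y == x then reduce [:: i; j; i; j] else [::].
  apply/eqP; rewrite /w; elim/letter_ind: i {w}; elim/letter_ind: j;
  by elim/letter_ind: x; elim/letter_ind: y; vm_compute.
have -> : img w y = y.
  apply/eqP; rewrite /w; elim/letter_ind: i {w}; elim/letter_ind: j;
  by elim/letter_ind: x; elim/letter_ind: y; vm_compute.
by case: eqP => //; rewrite ev_reduce.
Qed.

Lemma ev_consE k w : ev (k :: w) = gen k * ev w.
Proof. by []. Qed.

(** The words k w k w^-1 are products of conjugates of commutators of
    generators: [k, l w] = [k, l] [k, w]^l since generators are
    involutions. *)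
Lemma liftable_swap k w : liftable (gen k * ev w * gen k * (ev w)^-1).
Proof.
elim: w => [|l w IHw]; first by rewrite invg1 !mulg1 genK; exact: liftable1.
have := liftableM (liftable_comm k l) (liftableJ l IHw); congr liftable.
rewrite conjgE !ev_consE mulg1 invgM genV !mulgA.
rewrite -(mulgA _ (gen l) (gen l)) genK mulg1.
by rewrite -(mulgA _ (gen k) (gen k)) genK mulg1.
Qed.

(** In a word with even parities the first letter k occurs again, and moving
    it next to that occurrence costs a factor covered by liftable_swap; then
    the two letters cancel. *)
Lemma liftable_even w : (forall k, par w k = false) -> liftable (ev w).
Proof.
have [n] := ubnP (size w); elim: n w => // n IHn [|k w] /ltnSE le_wn w0.
  exact: liftable1.
have : k \in w.
  apply: contraFT (w0 k) => kw; rewrite par_cons eqxx.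
  by rewrite /par (count_memPn kw).
move=> kw; case/splitPr: kw le_wn w0 => u v le_wn w0.
have -> : ev (k :: u ++ k :: v)
    = gen k * ev u * gen k * (ev u)^-1 * ev (u ++ v).
  by rewrite ev_consE !ev_cat ev_consE !mulgA mulgVK.
apply: liftableM; first exact: liftable_swap.
apply: IHn => [|l].
  by apply: leq_trans le_wn; rewrite /= !size_cat /= addnS ltnS leqnSn.
move: (w0 l); rewrite par_cons !par_cat par_cons.
by case: (k == l); case: par; case: par.
Qed.

Lemma lift_vertex w v : (forall k, par w k = false) -> exists w',
  [/\ forall k, par w' k = false, forall u, ev w' (v ++ u) = v ++ ev w u
    & forall t, ~~ prefix v t -> ev w' t = t].
Proof.
move=> w0; elim: v => [|x v [w1 [w1_0 w1v w1t]]].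
  by exists w; split=> // t; rewrite prefix0s.
have [w2 w2E] := liftable_even w1_0 x; exists w2; split=> [k|u|[|y t]].
- have e y : par (sec w2 y) k = false.
    case: (eqVneq y x) => yx.
      rewrite -(w1_0 k) yx; apply: eq_par; apply: autP.
      by apply: (@ev_sec_eq _ _ x) => u; rewrite w2E eqxx.
    apply: ev1_par; apply: autP; apply: (@ev_sec_eq _ _ y id) => u.
    by rewrite w2E (negPf yx).
  by rewrite par_sec !e.
- by rewrite cat_cons w2E eqxx w1v.
- by rewrite aut_root.
- by rewrite w2E prefix_cons; case: eqVneq => // _ /w1t ->.
Qed.

(** The cube of the word i j has states conjugate to i j at all three
    vertices, so some such cube t has the parities of w at all its states;
    the states are then corrected by liftable_even. *)
Lemma diag w : odd (size w) = false -> exists w',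
  (forall y u, ev w' (y :: u) = y :: ev w u) /\ (forall k, par w' k = par w k).
Proof.
move=> wev.
pose r i j : word := [:: i; j; i; j; i; j].
pose t := if par w l1 then if par w l2 then r l1 l2 else r l1 l3
          else if par w l2 then r l2 l3 else [::].
have timg y : img t y = y.
  by rewrite /t; case: par; case: par; elim/letter_ind: y; apply: val_inj.
have tpar y k : par (sec t y) k = par w k.
  have: par w l3 = par w l1 (+) par w l2.
    by move: wev; rewrite odd_size_par; case: par; case: par; case: par.
  rewrite /t; elim/letter_ind: k; case: (par w l1); case: (par w l2) => e;
  by rewrite ?e; elim/letter_ind: y.
have /all_sig[c cE] y : {c | forall z u, ev c (z :: u)
     = z :: (if z == y then ev (rev (sec t y) ++ w) u else u)}.
  apply/cid/liftable_even => k.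
  by rewrite par_cat par_rev tpar; case: par.
exists (t ++ c l1 ++ c l2 ++ c l3).
set w' := _ ++ _.
have w'E y u : ev w' (y :: u) = y :: ev w u.
  rewrite /w' !ev_cat !autM ev_cons timg.
  by elim/letter_ind: y; rewrite !cE /= ev_cat ev_rev autM autK.
split=> // k; rewrite (par_sec w').
have e y : par (sec w' y) k = par w k.
  by apply: eq_par; apply: autP; exact: ev_sec_eq (w'E y).
by rewrite !e; case: par.
Qed.

(** * Level stabilizers and rigid stabilizers *)

Definition fixes n w := forall u, size u = n -> ev w u = u.

Lemma fixes_img n w : fixes n.+1 w -> img w =1 id.
Proof.
move=> wn x; have := wn (x :: nseq n x); rewrite /= size_nseq => /(_ erefl).
by rewrite ev_cons => -[].
Qed.

Lemma fixes_sec n w x : fixes n.+1 w -> fixes n (sec w x).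
Proof.
move=> wn u un; have := wn (x :: u); rewrite /= un => /(_ erefl).
by rewrite ev_cons => -[].
Qed.

(** Every state strictly above level (size v) fixes two further levels or
    more, so that its own states fix the first level, have even length, and
    inherit its parities by sec_par_eq. *)
Lemma secs_par v w k : fixes (size v).+1 w -> par (secs w v) k = par w k.
Proof.
elim: v w => // x v IHv w wv; rewrite /= IHv; last exact: fixes_sec.
apply: sec_par_eq => [|y]; first exact: fixes_img wv.
exact/img_id_even/fixes_img/fixes_sec/wv.
Qed.

(** Iterating diag, the n-th power of the diagonal map g |-> (g, g, g). *)
Lemma fixes_par w n : odd (size w) = false ->
  exists2 w', fixes n w' & forall k, par w' k = par w k.
Proof.
move=> wev; elim: n => [|n [w1 w1n w1w]].
  by exists w => // u /size0nil ->; rewrite aut_root.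
have [|w2 [w2E w2w1]] := @diag w1.
  by rewrite odd_size_par !w1w -odd_size_par.
exists w2 => [[|x u] //= [un]|k]; last by rewrite w2w1.
by rewrite w2E w1n.
Qed.

Definition word_image : {pred aut} := fun g => `[< exists w, g = ev w >].

Fact word_imageM : mulg_closed word_image.
Proof.
move=> g h /asboolP[v ->] /asboolP[w ->]; apply/asboolP.
by exists (v ++ w); rewrite ev_cat.
Qed.
Fact word_image1 : 1 \in word_image.
Proof. by apply/asboolP; exists [::]. Qed.
Fact word_imageV : invg_closed word_image.
Proof.
by move=> g /asboolP[w ->]; apply/asboolP; exists (rev w); rewrite ev_rev.
Qed.
HB.instance Definition _ := isMulClosed.Build aut word_image word_imageM.
HB.instance Definition _ := isMul1Closed.Build aut word_image word_image1.
HB.instance Definition _ := isInvClosed.Build aut word_image word_imageV.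

Lemma ev_Gamma w : ev w \in Gamma.
Proof.
elim: w => [|k w IHw]; first exact: gpred1.
apply: gpredM => //; apply: mem_generated.
by elim/letter_ind: k; rewrite !inE eqxx ?orbT.
Qed.

Lemma Gamma_word (g : subgrp Gamma) : exists w, val g = ev w.
Proof.
apply/asboolP; rewrite -[asbool _]/(val g \in word_image).
have /generatedP := valP g; apply => h; rewrite !inE => /or3P[]/eqP->.
- by apply/asboolP; exists [:: l1]; rewrite /= mulg1.
- by apply/asboolP; exists [:: l2]; rewrite /= mulg1.
- by apply/asboolP; exists [:: l3]; rewrite /= mulg1.
Qed.

Definition elt (w : word) : subgrp Gamma := exist _ (ev w) (ev_Gamma w).

Lemma elt_cat v w : elt (v ++ w) = elt v * elt w.
Proof. by apply: val_inj; rewrite valM /= ev_cat. Qed.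

Lemma elt_rev w : elt (rev w) = (elt w)^-1.
Proof. by apply: val_inj; exact: ev_rev. Qed.

Lemma eltP (g : subgrp Gamma) : exists w, g = elt w.
Proof. by have [w gw] := Gamma_word g; exists w; apply: val_inj. Qed.

Lemma stab_elt n w : reflect (fixes n w) (elt w \in @stab Gamma n).
Proof. exact: asboolP. Qed.

Lemma stab_le m n (g : subgrp Gamma) :
  m <= n -> g \in @stab Gamma n -> g \in @stab Gamma m.
Proof.
move/subnK <-; elim: (n - m)%N => // d IHd gS; apply: IHd.
exact: stabS gS.
Qed.

Lemma fixes_trivial n w : fixes n w ->
  (forall v, size v = n -> ev (secs w v) = 1) -> ev w = 1.
Proof.
move=> wn w1; apply: autP => u.
have [le_nu|/ltnW le_un] := leqP n (size u); last first.
  have /stab_elt/(stab_le le_un)/stab_elt := wn; exact.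
have un : size (take n u) = n by rewrite size_takel.
by rewrite -(cat_take_drop n u) ev_secs wn // w1.
Qed.

(** The states at the vertices of L are removed one by one, each by an element
    of a rigid vertex stabilizer obtained from lift_vertex. *)
Lemma rist_vertices n (L : seq vertex) w : fixes n w ->
  (forall v, size v = n -> forall k, par (secs w v) k = false) ->
  (forall v, size v = n -> v \notin L -> ev (secs w v) = 1) ->
  elt w \in @rist Gamma n.
Proof.
elim: L w => [|v L IHL] w wn w0 w1.
  have -> : elt w = 1
    by apply: val_inj; exact: fixes_trivial wn (fun v vn => w1 v vn isT).
  exact: gpred1.
have [vn|vn] := eqVneq (size v) n; last first.
  apply: IHL => // t tn tL; apply: w1; rewrite // inE negb_or tL andbT.
  by apply: contra vn => /eqP <-; apply/eqP.
have [w2 [_ w2v w2t]] := lift_vertex v (w0 v vn).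
have -> : elt w = elt w2 * elt (rev w2 ++ w).
  by rewrite elt_cat elt_rev mulVKg.
apply: gpredM.
  by apply: mem_generated; apply/asboolP; exists v; last exact/asboolP.
have zE t u : size t = n -> ev (rev w2 ++ w) (t ++ u)
     = t ++ (if t == v then u else ev (secs w t) u).
  move=> tn; rewrite ev_cat ev_rev autM; case: eqVneq => [->|tv].
    have {1}-> : u = ev (secs w v) ((ev (secs w v))^-1 u) by rewrite autVK.
    by rewrite -w2v autK ev_secs wn // autVK.
  have -> : (ev w2)^-1 (t ++ u) = t ++ u; last by rewrite ev_secs wn.
  apply: (@aut_inj (ev w2)); rewrite autVK w2t //.
  by apply: contra tv; rewrite prefixE vn -tn take_size_cat.
have zn : fixes n (rev w2 ++ w).
  move=> t tn; have := zE t [::] tn; rewrite cats0 => ->.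
  by case: eqP; rewrite ?aut_root cats0.
have zs t : size t = n ->
    ev (secs (rev w2 ++ w) t) = if t == v then 1 else ev (secs w t).
  move=> tn; apply: autP => u.
  have /eqP := zE t u tn; rewrite ev_secs zn // eqseq_cat // eqxx => /eqP ->.
  by case: eqP.
apply: IHL => // t tn => [k|tL]; have := zs t tn; case: eqVneq => [_|tv] //.
- exact: ev1_par.
- by move=> ze; rewrite (eq_par k ze); exact: w0.
- by move=> ->; apply: w1; rewrite // inE negb_or tv.
Qed.

(** secs_par needs one level more than n.+1 to control the states at level
    n.+1. *)
Lemma rist_even n w : fixes n.+2 w -> (forall k, par w k = false) ->
  elt w \in @rist Gamma n.+1.
Proof.
move=> wn w0; have wn1 : fixes n.+1 w by apply/stab_elt/stabS/stab_elt.
apply: (@rist_vertices _ [seq val t | t in {: n.+1.-tuple letter}]) => // v vn.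
  by move=> k; rewrite secs_par ?vn.
case/negP; apply/imageP; exists (insubd [tuple of nseq n.+1 l1] v) => //.
by rewrite val_insubd vn eqxx.
Qed.

(** * The parity morphism *)

(** The third parity is the sum of the other two on words of even length, in
    particular on all elements of Stab(1). *)
Definition parities (w : word) : 'Z_2 * 'Z_2 :=
  (inZp (par w l1), inZp (par w l2)).

Lemma parities_cat v w : parities (v ++ w) = parities v * parities w.
Proof.
rewrite /parities !par_cat; congr (_, _); apply: val_inj;
by case: (par v _); case: (par w _).
Qed.

Lemma parities1 w : odd (size w) = false -> parities w = 1 ->
  forall k, par w k = false.
Proof.
rewrite odd_size_par => + /eqP; rewrite xpair_eqE => + /andP[/eqP e1 /eqP e2].
move: e1 e2 => /(congr1 val) + /(congr1 val).
case p1: (par w l1) => // _; case p2: (par w l2) => // _ p3.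
by elim/letter_ind.
Qed.

Definition gamma_word (g : subgrp Gamma) : word := projT1 (cid (Gamma_word g)).

Lemma gamma_wordK (g : subgrp Gamma) : elt (gamma_word g) = g.
Proof. by rewrite /gamma_word; case: cid => w gw; exact: val_inj. Qed.

Definition chi (g : subgrp Gamma) : 'Z_2 * 'Z_2 := parities (gamma_word g).

Lemma chi_elt w : chi (elt w) = parities w.
Proof.
have /(congr1 val)/= e := gamma_wordK (elt w).
by rewrite /chi /parities !(eq_par _ e).
Qed.

Fact chi_morph : monoid_morphism chi.
Proof.
split=> [|g h].
  have -> : 1 = elt [::] by exact: val_inj.
  by rewrite chi_elt; congr (_, _); apply: val_inj.
by rewrite -(gamma_wordK g) -(gamma_wordK h) -elt_cat !chi_elt parities_cat.
Qed.

HB.instance Definition _ :=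
  isUMagmaMorphism.Build (subgrp Gamma) ('Z_2 * 'Z_2)%type chi chi_morph.

Lemma eq_chi g h : chi (g^-1 * h) = 1 <-> chi g = chi h.
Proof.
have -> : chi (g^-1 * h) = (chi g)^-1 * chi h.
  by rewrite -[(chi g)^-1](gmulfV chi g); exact: gmulfM.
split=> [gh|->]; last by rewrite mulVg.
by rewrite -(mulVKg (chi g) (chi h)) gh mulg1.
Qed.

Lemma rist_chi n : {subset @rist Gamma n.+1 <= kernel chi}.
Proof.
move=> g /generatedP; apply=> {}g /asboolP[u un gR].
have [w gw] := eltP g; rewrite gw in gR *.
have wS : fixes n.+1 w.
  by apply/stab_elt/rist_stab/mem_generated/asboolP; exists u.
case: u un gR => // x u _ /asboolP wR.
have w0 : forall k, par w k = false.
  apply: (@sec_par0 _ x); first exact: fixes_img wS.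
  move=> y yx; apply: autP; apply: (@ev_sec_eq _ _ y id) => v.
  by rewrite wR // prefix_cons eq_sym (negPf yx).
apply/eqP; rewrite -[LHS]/(chi (elt w)) chi_elt /parities !w0.
by congr (_, _); apply: val_inj.
Qed.

Lemma stab_chi_rist n (g : subgrp Gamma) :
  g \in @stab Gamma n.+2 -> chi g = 1 -> g \in @rist Gamma n.+1.
Proof.
have [w ->] := eltP g => wS; rewrite chi_elt => w1.
apply: rist_even; first exact/stab_elt.
apply: parities1 w1; apply/img_id_even/(@fixes_img 0)/stab_elt.
exact: stab_le wS.
Qed.

Lemma stab_chi n (y : 'Z_2 * 'Z_2) : exists2 g, g \in @stab Gamma n & chi g = y.
Proof.
pose b i : bool := i != 1 :> 'Z_2.
pose w := nseq (b y.1) l1 ++ nseq (b y.2) l2 ++ nseq (b y.1 (+) b y.2) l3.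
have [|w' w'n w'w] := @fixes_par w n.
  by rewrite !size_cat !size_nseq !oddD !oddb; case: (b _); case: (b _).
exists (elt w'); first exact/stab_elt.
rewrite chi_elt /parities !w'w /w /b {b w w'n w'w}.
by case: y => [[[|[|i]] i2] [[|[|j]] j2]]; congr (_, _); apply: val_inj.
Qed.

(** * The rigid kernel *)

Definition rep (x : rigid_kernel Gamma) (n : nat) : subgrp Gamma :=
  repr (val (val x) n : quot (@rist Gamma n.+1)).

Lemma pi_rep x n : \pi_(quot (@rist Gamma n.+1)) (rep x n) = val (val x) n.
Proof. exact: reprK. Qed.

Lemma pi_repS x n :
  \pi_(quot (@rist Gamma n.+1)) (rep x n.+1) = val (val x) n.
Proof. by have /asboolP/(_ n) := valP (val x). Qed.

Lemma rep_stab x n : rep x n \in @stab Gamma n.+1.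
Proof.
have /eqP/(congr1 (fun z => val z n)) := valP x.
move=> /(@eq_quotP _ (@stab Gamma n.+1) (rep x n) 1).
by rewrite mulg1 gpredV.
Qed.

Lemma chi_eq_rist n g h :
  \pi_(quot (@rist Gamma n.+1)) g = \pi_(quot (@rist Gamma n.+1)) h ->
  chi g = chi h.
Proof.
by move=> /eq_quotP/rist_chi/eqP/eq_chi.
Qed.

Definition chi_kernel (x : rigid_kernel Gamma) : 'Z_2 * 'Z_2 := chi (rep x 0).

(** Consecutive terms have the same class modulo Rist(n.+1), which lies in the
    kernel of chi. *)
Lemma chi_rep x n : chi (rep x n) = chi_kernel x.
Proof.
elim: n => // n <-; apply: (@chi_eq_rist n).
by rewrite pi_rep pi_repS.
Qed.

Lemma quot_piM (G : groupType) (N : normalClosed G) (x y : G) :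
  \pi_(quot N) (x * y) = (\pi_(quot N) x : quot N) * \pi_(quot N) y.
Proof. exact: esym (quot_mulE N x y). Qed.

Lemma seqprodM (T : nat -> groupType) (f g : seqprod T) n :
  (f * g) n = f n * g n.
Proof. by []. Qed.

Lemma chi_kernelM x y : chi_kernel (x * y) = chi_kernel x * chi_kernel y.
Proof.
have xyE : \pi_(quot (@rist Gamma 1)) (rep (x * y) 0)
    = \pi_(quot (@rist Gamma 1)) (rep x 0 * rep y 0).
  by rewrite (pi_rep (x * y)) !valM quot_piM seqprodM 2!pi_rep.
rewrite /chi_kernel (chi_eq_rist xyE); exact: gmulfM.
Qed.

(** The representative rep x n.+1 of the next term of x still represents its
    n-th term, a class modulo Rist(n.+1), but it lies in Stab(n.+2); so it
    lies in Rist(n.+1) as soon as chi is trivial on it. *)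
Lemma chi_kernel_inj : injective chi_kernel.
Proof.
have ker1 x : chi_kernel x = 1 -> x = 1.
  move=> x1; do 2!apply: val_inj; apply: functional_extensionality_dep => n.
  rewrite -pi_repS; apply/eq_quotP; rewrite mulg1 gpredV.
  by apply: stab_chi_rist; [exact: rep_stab | rewrite chi_rep].
move=> x y xy; apply: (mulIg y^-1); rewrite mulgV; apply: ker1.
rewrite chi_kernelM xy -chi_kernelM mulgV.
by apply: (mulgI (chi_kernel 1)); rewrite -chi_kernelM !mulg1.
Qed.

(** Elements of the level stabilizers with the same value of chi form a
    compatible sequence, whatever the choices, by stab_chi_rist. *)
Lemma chi_kernel_surj y : exists x, chi_kernel x = y.
Proof.
have hex n : exists g : subgrp Gamma, (g \in @stab Gamma n.+2) && (chi g == y).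
  by have [g gS <-] := stab_chi n.+2 y; exists g; rewrite gS eqxx.
pose h n := projT1 (cid (hex n)).
have hS n : h n \in @stab Gamma n.+2 by rewrite /h; case: cid => g /= /andP[].
have hy n : chi (h n) = y by rewrite /h; case: cid => g /= /andP[_ /eqP].
pose s : seqprod (obj (branch_system Gamma)) :=
  fun n => \pi_(quot (@rist Gamma n.+1)) (h n).
have sC : s \in @compatible (branch_system Gamma).
  apply/asboolP => n; rewrite /s /= quot_projE; apply/eq_quotP.
  apply: stab_chi_rist; last by apply/eq_chi; rewrite !hy.
  by apply: gpredM; rewrite ?gpredV //; exact: stabS.
pose x : branch_completion Gamma := exist _ s sC.
have xK : x \in kernel (branch_to_congruence Gamma).
  apply/eqP/val_inj/functional_extensionality_dep => n.
  rewrite -[LHS]/(quot_proj (@rist_stab Gamma n.+1) (s n)) quot_projE.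
  by apply/eq_quotP; rewrite mulg1 gpredV; exact: stabS.
exists (exist _ x xK); rewrite -(hy 0); apply: (@chi_eq_rist 0).
by rewrite pi_rep.
Qed.

Theorem theorem10 : isomorphic (rigid_kernel Gamma) ('Z_2 * 'Z_2)%type.
Proof.
pose f := HB.pack_for {multiplicative rigid_kernel Gamma -> ('Z_2 * 'Z_2)%type}
  chi_kernel (isMultiplicative.Build _ _ chi_kernel chi_kernelM).
exists f; pose g y := projT1 (cid (chi_kernel_surj y)).
have gK : cancel g chi_kernel by move=> y; rewrite /g; case: cid.
exists g => //; exact: inj_can_sym gK chi_kernel_inj.
Qed.
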